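(* Let $G$ be a hereditary Lindelöf locally compact group and $X$ a second countable, locally quasi-compact, almost Hausdorff $G$-space. Then the following are equivalent: 1. The orbit space $G\setminus X$ is almost Hausdorff. 2. $G\setminus X$ is a $T_0$-space. 3. Every orbit is a homogeneous space.
   Context: All topological groups and the spaces $X$ on which they act are assumed to be $T_0$ (hence topological groups are Hausdorff). A $G$-space is a topological space $X$ with a continuous map $G\times X\to X$, $(g,x)\mapsto g\cdot x$, such that $g\cdot(h\cdot x)=(gh)\cdot x$ and $e\cdot x=x$. The orbit space $G\setminus X$ is the set of $G$-orbits with the quotient topology. A space is quasi-compact if every open cover has a finite subcover; locally quasi-compact if every neighborhood of every point $x$ contains a quasi-compact neighborhood of $x$; locally compact means locally quasi-compact and Hausdorff. A space is Lindelöf if every open cover has a countable subcover, and hereditary Lindelöf if every open subset is Lindelöf in the relative topology. A space is almost Hausdorff if every non-empty closed subset $A$ contains a non-empty, relatively open (in $A$) Hausdorff subset. For $x\in X$ put $G_x=\{g\in G: g\cdot x=x\}$ (a closed subgroup). The orbit $G\cdot x$, with the relative topology of $X$, is a homogeneous space if the map $G/G_x\to G\cdot x$, $gG_x\mapsto g\cdot x$, is a homeomorphism. *)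

(* Defs.v *)
From HB Require Import structures.
From mathcomp Require Import all_boot all_order all_algebra generic_quotient.
From mathcomp Require Import all_classical all_reals all_analysis.

Set Implicit Arguments.
Unset Strict Implicit.
Unset Printing Implicit Defensive.

Local Open Scope classical_set_scope.
Local Open Scope quotient_scope.
Local Open Scope group_scope.

(* [cover_compact] is the open-cover property, without any separation axiom;
   the library's [locally_compact] asks for closed compact neighbourhoods of
   points, which is not the right notion for non-Hausdorff spaces. *)
Definition locally_quasi_compact (T : topologicalType) : Prop :=
  forall (x : T) (U : set T), nbhs x U ->
    exists K : set T, [/\ nbhs x K, K `<=` U & cover_compact K].

Definition locally_compact_hausdorff (T : topologicalType) : Prop :=
  locally_quasi_compact T /\ hausdorff_space T.

Definition lindelof (T : topologicalType) : Prop :=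
  forall C : set (set T), C `<=` open -> \bigcup_(U in C) U = setT ->
    exists D : set (set T),
      [/\ D `<=` C, countable D & \bigcup_(U in D) U = setT].

(* Subsets are used below as spaces through [set_type], which carries the
   relative topology. *)
Definition hereditary_lindelof (T : topologicalType) : Prop :=
  forall U : set T, open U -> lindelof (set_type U).

Definition almost_hausdorff (T : topologicalType) : Prop :=
  forall A : set T, closed A -> A !=set0 ->
    exists V : set T,
      [/\ open V, A `&` V !=set0 & hausdorff_space (set_type (A `&` V))].

Definition homeomorphism (S T : topologicalType) (f : S -> T) : Prop :=
  continuous f /\
  exists g : T -> S, [/\ cancel f g, cancel g f & continuous g].

HB.structure Definition PreTopologicalGroup :=
  {G of Topological G & Group G}.

HB.mixin Record PreTopologicalGroup_isTopologicalGroup G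
    of PreTopologicalGroup G := {
  mulg_continuous : continuous (fun p : G * G => p.1 * p.2 : G) ;
  invg_continuous : continuous (fun g : G => g^-1 : G)
}.

#[short(type="topologicalGroupType")]
HB.structure Definition TopologicalGroup :=
  {G of PreTopologicalGroup G & PreTopologicalGroup_isTopologicalGroup G}.

Record gspace (G : topologicalGroupType) (X : topologicalType) := GSpace {
  act :> G -> X -> X ;
  act_continuous : continuous (fun p : G * X => act p.1 p.2) ;
  actM : forall (g h : G) (x : X), act g (act h x) = act (g * h) x ;
  act1 : forall x : X, act 1 x = x
}.

Section GSpace.
Context (G : topologicalGroupType) (X : topologicalType) (a : gspace G X).
Implicit Types (g h k : G) (x y z : X).

Definition gorbit x : set X := [set a g x | g in setT].

Definition stabilizer x : set G := [set g | a g x = x].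

Lemma actK g x : a g^-1 (a g x) = x.
Proof. by rewrite actM mulVg act1. Qed.

Definition orbit_rel : rel X := fun x y => `[< gorbit x y >].

Lemma orbit_rel_refl : reflexive orbit_rel.
Proof. by move=> x; apply/asboolP; exists 1 => //; exact: act1. Qed.

Lemma orbit_rel_sym : symmetric orbit_rel.
Proof.
have H x y : orbit_rel x y -> orbit_rel y x.
  by move=> /asboolP[g _ <-]; apply/asboolP; exists g^-1 => //; exact: actK.
by move=> x y; apply/idP/idP; exact: H.
Qed.

Lemma orbit_rel_trans : transitive orbit_rel.
Proof.
move=> y x z /asboolP[g _ <-] /asboolP[h _ <-]; apply/asboolP.
by exists (h * g) => //; rewrite actM.
Qed.

Canonical orbit_equiv :=
  EquivRel orbit_rel orbit_rel_refl orbit_rel_sym orbit_rel_trans.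

Definition orbit_space := {eq_quot orbit_equiv}.

HB.instance Definition _ :=
  Topological.copy orbit_space (quotient_topology orbit_space).
HB.instance Definition _ := Quotient.on orbit_space.

Section Cosets.
Context (x : X).

(* [g] and [h] lie in the same left coset of the stabilizer. *)
Definition lcoset_rel : rel G := fun g h => `[< stabilizer x (g^-1 * h) >].

Lemma lcoset_relP g h : reflect (a g x = a h x) (lcoset_rel g h).
Proof.
apply: (iffP (asboolP _)); rewrite /stabilizer /= -actM => E.
  by rewrite -[in LHS]E actM mulgV act1.
by rewrite -E actK.
Qed.

Lemma lcoset_rel_refl : reflexive lcoset_rel.
Proof. by move=> g; apply/lcoset_relP. Qed.

Lemma lcoset_rel_sym : symmetric lcoset_rel.
Proof. by move=> g h; apply/lcoset_relP/lcoset_relP => ->. Qed.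

Lemma lcoset_rel_trans : transitive lcoset_rel.
Proof.
by move=> h g k /lcoset_relP gh /lcoset_relP hk; apply/lcoset_relP; rewrite gh.
Qed.

Canonical lcoset_equiv :=
  EquivRel lcoset_rel lcoset_rel_refl lcoset_rel_sym lcoset_rel_trans.

Definition stabilizer_quotient := {eq_quot lcoset_equiv}.

HB.instance Definition _ :=
  Topological.copy stabilizer_quotient (quotient_topology stabilizer_quotient).
HB.instance Definition _ := Quotient.on stabilizer_quotient.

Lemma act_orbit g : a g x \in gorbit x.
Proof. by apply/mem_set; exists g. Qed.

(* Defined on the chosen representative of each coset; [orbit_mapE] shows that
   it does not depend on that choice. *)
Definition orbit_map (c : stabilizer_quotient) : set_type (gorbit x) :=
  exist _ (a (repr c) x) (act_orbit (repr c)).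

Lemma orbit_mapE g : set_val (orbit_map (\pi_stabilizer_quotient g)) = a g x.
Proof. by apply/lcoset_relP/eqmodP; rewrite reprK. Qed.

Definition homogeneous_orbit : Prop := homeomorphism orbit_map.

End Cosets.
End GSpace.

(* Main.v *)
(* The pivot is the property that g |-> g x is open onto the orbit of x, which is
   condition 3 pointwise.  If the orbit space is T0 then it is second countable
   and T0, so G x is a dense G_delta in its closure; a Hausdorff open piece of
   that closure is a Baire space, covered by the complement of G x and countably
   many translates of V x (V a compact neighbourhood of 1), so V x has interior.  Conversely, openness makes every orbit open in its closure, which
   separates orbits.  Finally, for a compact neighbourhood N of 1, openness and a
   second Baire argument over a countable base yield, inside any closed invariant
   set A, a nonempty relatively open U with G x /\ U contained in N x for every x
   in U; compactness of N then makes the orbit space of U Hausdorff. *)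
Require Import Defs.
From mathcomp Require Import all_boot all_order all_algebra.
From mathcomp Require Import generic_quotient finmap.
From mathcomp Require Import all_classical all_reals all_analysis.

Set Implicit Arguments.
Unset Strict Implicit.
Unset Printing Implicit Defensive.

Local Open Scope classical_set_scope.
Local Open Scope quotient_scope.
Local Open Scope group_scope.

(** * Compactness and Hausdorff traces *)

(** Without a cluster point in [K], the open sets whose complements belong to the filter cover [K],
    and a finite subcover contradicts properness. *)
Lemma cover_compact_compact (T : topologicalType) (K : set T) :
  cover_compact K -> compact K.
Proof.
move=> Kco F FF FK; apply: contrapT => noc.
have [||D' D'D KD'] := Kco _ [set U : set T | open U /\ F (~` U)] id.
- by move=> U [].
- move=> x Kx; have : ~ cluster F x by move=> cx; apply: noc; exists x.
  rewrite clusterEonbhs /= => /existsNP[P /existsNP[Q]].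
  move=> /not_implyP[FP /not_implyP[[ oQ Qx] PQ]].
  exists Q => //; split=> //; apply: filterS FP => z Pz Qz.
  by apply: PQ; exists z.
- have : F (\bigcap_(U in [set` D']) ~` U).
    by apply: filter_bigI => U /D'D; rewrite inE => -[].
  move=> /(filterI FK)/filter_ex[z [/KD'[U /= UD' Uz] /(_ _ UD')]].
  exact.
Qed.

(** Points and neighbourhoods stay in the ambient space, and disjointness is required only on [B].
    This avoids [set_type] in the arguments below. *)
Definition hausdorff_on (T : topologicalType) (B : set T) : Prop :=
  forall u v, B u -> B v -> u <> v ->
    exists O P : set T, [/\ open_nbhs u O, open_nbhs v P & O `&` P `&` B = set0].

Lemma hausdorff_onP (T : topologicalType) (B : set T) :
  hausdorff_space (set_type B) <-> hausdorff_on B.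
Proof.
rewrite open_hausdorff; split=> [H u v Bu Bv uv|H [u Bu] [v Bv] uv].
  have [|[U V] /= UV [[ O oO UE] [P oP VE] /eqP OP]] :=
    H (exist _ u (mem_set Bu)) (exist _ v (mem_set Bv)).
    by apply/eqP => -[].
  move: UV OP; rewrite -UE -VE !inE => -[Ou Pv] OP; exists O, P; split=> //.
  apply/seteqP; split=> z //= [[Oz Pz] Bz].
  have : set0 (exist _ z (mem_set Bz) : set_type B) by rewrite -OP.
  by [].
have [|O [P [[ oO Ou] [ oP Pv] OP]]] := H u v (set_mem Bu) (set_mem Bv).
  by move=> E; move/eqP: uv; apply; exact: eq_sig_hprop.
exists (set_val @^-1` O, set_val @^-1` P); first by rewrite !inE.
split; [by exists O|by exists P|].
apply/eqP/seteqP; split=> -[z Bz] //= [Oz Pz].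
have : set0 z by rewrite -OP; split=> //; exact: set_mem.
by [].
Qed.

Lemma hausdorff_onS (T : topologicalType) (B C : set T) :
  C `<=` B -> hausdorff_on B -> hausdorff_on C.
Proof.
move=> CB hB u v /CB Bu /CB Bv /(hB _ _ Bu Bv)[ O [P [Ou Pv OP]]].
exists O, P; split=> //; apply/seteqP; split=> z // [Oz /CB Bz].
by rewrite -OP.
Qed.

(** A tube argument: the neighbourhoods separating [f (n, x)] from [y] inside [B] can be made
    uniform in [n] by compactness of [N]. *)
Lemma compact_separation (S T X : topologicalType) (f : S * T -> X)
    (B : set X) (N : set S) (x : T) (y : X) :
  continuous f -> hausdorff_on B -> compact N ->
  (forall n, N n -> B (f (n, x))) -> B y ->
  (forall n, N n -> f (n, x) <> y) ->
  \forall p \near x & q \near y,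
    forall n, N n -> B (f (n, p)) -> B q -> f (n, p) <> q.
Proof.
move=> fc hB /compact_near_coveringP Nco NB By Ny.
have := Nco _ (filter_prod (nbhs x) (nbhs y))
  (fun pq n => B (f (n, pq.1)) -> B pq.2 -> f (n, pq.1) <> pq.2).
apply=> n Nn.
have [ O [P [[ oO On] [ oP Py] OP]]] := hB _ _ (NB n Nn) By (Ny n Nn).
have : nbhs (n, x) (f @^-1` O).
  by apply: fc; exact: open_nbhs_nbhs.
move=> [[N' M'] /= [N'n M'x] NMO].
exists (N', M' `*` P); first split=> //=.
  by exists (M', P) => //; split => //; exact: open_nbhs_nbhs.
move=> [n' [p q]] /= [N'n' [M'p Pq]] Bf Bq fpq.
have : set0 q by rewrite -OP; split=> //; split=> //; rewrite -fpq; exact: NMO.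
by [].
Qed.

(** * Baire category in a Hausdorff trace of a closed set *)

(** As for locally compact spaces, nested quasi-compact neighbourhoods are chosen inside the
    successive [U n]. They need not be closed in [X], so the cluster point of their traces on [A] is
    placed in each of them by Hausdorff separation. *)
Lemma baire_nat (X : topologicalType) (A W : set X) (U : nat -> set X) :
  locally_quasi_compact X -> closed A -> open W ->
  hausdorff_on (A `&` W) -> A `&` W !=set0 -> (forall n, open (U n)) ->
  (forall n O, open O -> A `&` W `&` O !=set0 ->
    A `&` W `&` O `&` U n !=set0) ->
  exists2 z, (A `&` W) z & forall n, U n z.
Proof.
move=> lqc Acl Wo hB B0 Uo Ud.
have step (nK : nat * set X) : exists K', A `&` W `&` nK.2^° !=set0 ->
    [/\ A `&` W `&` K'^° !=set0, cover_compact K' &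
        K' `<=` nK.2^° `&` U nK.1 `&` W].
  case: nK => n K /=; have [[z]|] := pselect (A `&` W `&` K^° !=set0); last first.
    by move=> ?; exists set0.
  move=> zP; have [|y [[[Ay Wy] Ky] Uy]] := Ud n _ (@open_interior _ K).
    by exists z.
  have [|K' [K'y sK' cK']] := lqc y (K^° `&` U n `&` W).
    apply: open_nbhs_nbhs; split=> //; apply: openI => //.
    by apply: openI => //; exact: open_interior.
  by exists K' => _; split=> //; exists y.
have [f fP] := choice step.
pose fix K n := if n is m.+1 then f (m, K m) else W.
have K0 n : A `&` W `&` (K n)^° !=set0.
  elim: n => [|n IH] /=; last by have [] := fP (n, K n) IH.
  by case: B0 => z [Az Wz]; exists z; split=> //; apply: open_nbhs_nbhs.
have Kco n : cover_compact (K n.+1) by have [] := fP (n, K n) (K0 n).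
have KS n : K n.+1 `<=` (K n)^° `&` U n `&` W by have [] := fP (n, K n) (K0 n).
have Kle n m : (n <= m)%N -> K m `<=` K n.
  move=> /subnK <-; elim: (m - n)%N => [//|k IH] z.
  by rewrite addSn => /KS[[/interior_subset/IH]].
pose F := filter_from [set: nat] (fun n => K n.+1 `&` A).
have FF : ProperFilter F.
  apply: filter_from_proper.
    apply: filter_from_filter; first by exists 0%N.
    move=> i j _ _; exists (maxn i j) => // z [Kz Az].
    by split; split=> //; apply: Kle Kz; rewrite ltnS ?leq_maxl ?leq_maxr.
  move=> n _; have [z [[Az _] Kz]] := K0 n.+1.
  by exists z; split=> //; exact: interior_subset.
have [|p [K1p clp]] := cover_compact_compact (Kco 0%N) (F := F).
  by exists 0%N => // z [].
have Ap : A p.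
  apply: Acl => Q Qp; apply: clp => //.
  by exists 0%N => // z [].
have Wp : W p by have [] := KS 0%N _ K1p.
exists p => // n.
suff /KS[[]] : K n.+1 p by [].
apply: contrapT => nKp.
have cN : compact (A `&` K n.+1).
  rewrite setIC; apply: compact_closedI => //.
  exact: cover_compact_compact.
(* With [fst] the parameter is a dummy: this says that the compact trace of [K n.+1] on [A] is
   closed in the Hausdorff trace of [W] on [A], so it misses a neighbourhood of [p]. *)
have := @compact_separation _ X X fst _ (A `&` K n.+1) p p _ hB cN _ _ _.
case.
- by move=> [u v]; exact: cvg_fst.
- by move=> u [Au /KS[_ Wu]].
- by [].
- by move=> u [_ Ku] /= E; apply: nKp; rewrite -E.
move=> [P Q] /= [Pp Qp] PQ.
have [|z [[Kz Az] Qz]] := clp (K n.+1 `&` A) Q _ Qp; first by exists n.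
have /= := PQ (p, z) (conj (nbhs_singleton Pp) Qz) z.
by apply=> //; split => //; have [] := KS _ _ Kz.
Qed.

(** The trace of [C] on [B] is relatively closed in that of an open [P] containing it. Such a set is
    nowhere dense in [B] as soon as it has no interior there. *)
Definition locally_closed_in (X : topologicalType) (B C : set X) : Prop :=
  exists P : set X, [/\ open P, B `&` C `<=` P &
    forall z, (B `&` P) z -> ~ C z -> nbhs z (~` (B `&` C))].

(* With F consisting of sets without interior in A `&` W this says that they do
   not cover it; complements of dense open sets are allowed in F, so a dense
   G_delta can be covered as well. *)
Lemma baire_cover (X : topologicalType) (A W : set X) (F : set (set X)) :
  locally_quasi_compact X -> closed A -> open W ->
  hausdorff_on (A `&` W) -> A `&` W !=set0 -> countable F ->
  (forall C, F C -> locally_closed_in (A `&` W) C) ->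
  A `&` W `<=` \bigcup_(C in F) C ->
  exists C O : set X,
    [/\ F C, open O, A `&` W `&` O !=set0 & A `&` W `&` O `<=` C].
Proof.
move=> lqc Acl Wo hB B0 /countable_injP[f finj] Flc Fcov.
apply: contrapT => noC.
(* If [n] numbers no member of [F], then [S n] is the whole space, so density is trivial. *)
pose S n := [set y | forall C, F C -> f C = n -> ~ (A `&` W `&` C) y].
have [||z Bz Uz] := @baire_nat X A W (fun n => (S n)^°) lqc Acl Wo hB B0.
- by move=> n; exact: open_interior.
- move=> n O oO BO0.
  have [[C [FC fC]]|nC] := pselect (exists C, F C /\ f C = n); last first.
    case: BO0 => z BOz; exists z; split=> //.
    apply: (filterS _ (filterT : nbhs z setT)) => y _ C FC fC.
    by case: nC; exists C.
  have SE y : S n y <-> ~ (A `&` W `&` C) y.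
    split=> [/(_ _ FC fC)//|nCy C' FC' fC'].
    by rewrite (finj C' C) ?inE // fC fC'.
  have {}SE : S n = ~` (A `&` W `&` C) by apply/seteqP; split=> y /SE.
  rewrite SE.
  have [P [ oP CP lcC]] := Flc _ FC.
  (* Inside [P], a point outside [C] has a neighbourhood missing [C]; if [O] misses [P] on the
     trace, then [O] itself misses [C] there. *)
  have [BOP0|BOP0] := pselect (A `&` W `&` (O `&` P) !=set0).
    have [z [[Bz [Oz Pz]] nCz]] : exists z, (A `&` W `&` (O `&` P)) z /\ ~ C z.
      apply: contrapT => /forallNP H; apply: noC; exists C, (O `&` P).
      split=> //; first exact: openI.
      by move=> z Bz; apply: contrapT => nCz; exact: (H z).
    by exists z; split=> //; apply: lcC.
  case: BO0 => z [Bz Oz]; exists z; split=> //.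
  apply: (filterS _ (open_nbhs_nbhs (conj oO Oz))) => y Oy BCy.
  by apply: BOP0; exists y; case: (BCy) => By _; split=> //; split=> //; exact: CP.
have [C FC Cz] := Fcov _ Bz.
by have /interior_subset/(_ _ FC erefl) := Uz (f C); apply.
Qed.

(** * Translations in a topological group *)

Lemma mulgl_continuous (G : topologicalGroupType) (g : G) :
  continuous (fun h : G => g * h).
Proof.
move=> h; apply: (@continuous_comp _ _ _ (pair g) (fun p : G * G => p.1 * p.2)).
  by apply: cvg_pair => //; exact: cvg_cst.
exact: mulg_continuous.
Qed.

Lemma mulgr_continuous (G : topologicalGroupType) (g : G) :
  continuous (fun h : G => h * g).
Proof.
move=> h; apply: (@continuous_comp _ _ _ (pair^~ g) (fun p : G * G => p.1 * p.2)).
  by apply: cvg_pair => //; exact: cvg_cst.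
exact: mulg_continuous.
Qed.

(** The open translates of the interior of [V] cover [G]; [D] collects one translating element for
    each member of a countable subcover. *)
Lemma lindelof_translates (G : topologicalGroupType) (V : set G) :
  hereditary_lindelof G -> nbhs 1 V ->
  exists2 D : set G, countable D & forall h, exists2 g, D g & V (g^-1 * h).
Proof.
move=> Ghl V1; have [||F [FC Fc Fcov]] := Ghl setT openT
  [set U | exists g : G, U = set_val @^-1` [set h | V^° (g^-1 * h)]].
- move=> _ [g ->]; exists [set h | V^° (g^-1 * h)] => //.
  by have /continuousP/(_ _ (@open_interior _ V)) := @mulgl_continuous G g^-1.
- apply/seteqP; split=> // h _.
  exists (set_val @^-1` [set h' | V^° ((set_val h)^-1 * h')]).
    by exists (set_val h).
  by rewrite /= mulVg.
have [|f fP] := @choice _ G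
    (fun U g => F U -> U = set_val @^-1` [set h | V^° (g^-1 * h)]).
  move=> U.
  have [/FC[g ->]|] := pselect (F U); first by exists g.
  by exists 1.
exists (f @` F); first exact: card_le_trans (card_image_le _ _) Fc.
move=> h; have : (\bigcup_(U in F) U) (exist _ h (mem_set I)) by rewrite Fcov.
move=> [U FU Uh]; exists (f U); first by exists U.
by have := fP U FU; move: (f U) => g E; move: Uh; rewrite E => /interior_subset.
Qed.

(** * Orbits, their closures and the orbit space *)

Section Action.
Context (G : topologicalGroupType) (X : topologicalType) (a : gspace G X).
Implicit Types (g h n : G) (x y z : X) (A B N W : set X).

Lemma actl_continuous g : continuous (a g).
Proof.
move=> x; apply: (@continuous_comp _ _ _ (pair g) (fun p : G * X => a p.1 p.2)).
  by apply: cvg_pair => //; exact: cvg_cst.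
exact: act_continuous.
Qed.

Lemma actr_continuous x : continuous (a ^~ x).
Proof.
move=> g; apply: (@continuous_comp _ _ _ (pair^~ x) (fun p : G * X => a p.1 p.2)).
  by apply: cvg_pair => //; exact: cvg_cst.
exact: act_continuous.
Qed.

Lemma actKV g x : a g (a g^-1 x) = x.
Proof. by rewrite actM mulgV act1. Qed.

Lemma act_inj g : injective (a g).
Proof. exact: can_inj (actK a g). Qed.

Lemma open_act_preimage g W : open W -> open (a g @^-1` W).
Proof. by move=> oW; have /continuousP/(_ _ oW) := @actl_continuous g. Qed.

Lemma act_near1 x W : open_nbhs x W ->
  exists2 V, nbhs 1 V & exists2 W', open_nbhs x W' &
    forall g y, V g -> W' y -> W (a g y).
Proof.
move=> [oW Wx]; have : nbhs (1 : G, x) [set p | W (a p.1 p.2)].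
  by apply: act_continuous; rewrite /= act1; exact: open_nbhs_nbhs.
move=> [[V W'] /= [V1 W'x] VW]; exists V => //; exists W'^°.
  by split; [exact: open_interior|].
by move=> g y Vg /interior_subset W'y; exact: (VW (g, y)).
Qed.

Lemma gorbit_trans x y z : gorbit a x y -> gorbit a y z -> gorbit a x z.
Proof. by move=> [g _ <-] [h _ <-]; exists (h * g) => //; rewrite actM. Qed.

Lemma gorbit_sym x y : gorbit a x y -> gorbit a y x.
Proof. by move=> [g _ <-]; exists g^-1 => //; exact: actK. Qed.

Definition invariant A := forall g x, A x -> A (a g x).

Lemma closure_gorbit_invariant x : invariant (closure (gorbit a x)).
Proof.
move=> g y cly Q /actl_continuous/cly[_ [[h _ <-] Qh]].
by exists (a g (a h x)); split=> //; exists (g * h) => //; rewrite actM.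
Qed.

Lemma gorbit_dense x W : open W -> closure (gorbit a x) `&` W !=set0 ->
  exists g, W (a g x).
Proof.
move=> oW [z [/(_ W) + Wz]] => -[|_ [[g _ <-] Wg]]; first exact: open_nbhs_nbhs.
by exists g.
Qed.

(** Some open piece of the orbit closure is Hausdorff; the dense orbit enters it at [a g x], and
    translation by the inverse of [g] brings the piece to [x]. *)
Lemma gorbit_closure_hausdorff_nbhs x : almost_hausdorff X ->
  exists2 W, open_nbhs x W & hausdorff_on (closure (gorbit a x) `&` W).
Proof.
move=> Xah; have clx : closure (gorbit a x) x.
  by apply: subset_closure; exists 1 => //; exact: act1.
have [|W [oW W0 /hausdorff_onP hW]] := Xah _ (@closed_closure _ (gorbit a x)).
  by exists x.
have [g Wg] := gorbit_dense oW W0.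
exists (a g @^-1` W); first by split=> //; exact: open_act_preimage.
move=> u v [clu Wu] [clv Wv] uv.
have [||E|U [V [[oU Uu] [oV Vv] UV]]] := hW (a g u) (a g v).
- by split=> //; exact: closure_gorbit_invariant.
- by split=> //; exact: closure_gorbit_invariant.
- by apply: uv; exact: act_inj E.
exists (a g @^-1` U), (a g @^-1` V); split.
- by split=> //; exact: open_act_preimage.
- by split=> //; exact: open_act_preimage.
apply/seteqP; split=> z // [UVz [clz Wz]].
have : set0 (a g z).
  by rewrite -UV; split=> //; split=> //; exact: closure_gorbit_invariant.
by [].
Qed.

(* Openness at the identity of [g |-> a g x] onto the orbit of x. *)
Definition orbit_map_open x := forall N : set G, nbhs 1 N ->
  exists2 O : set X, open_nbhs x O &
    forall g, O (a g x) -> exists2 n, N n & a n x = a g x.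

Lemma act_separation (N : set G) x y B :
  hausdorff_on B -> compact N -> (forall n, N n -> B (a n x)) -> B y ->
  (forall n, N n -> a n x <> y) ->
  exists P Q : set X, [/\ open_nbhs x P, open_nbhs y Q &
    forall n p, N n -> P p -> B (a n p) -> ~ Q (a n p)].
Proof.
move=> hB cN NB By Ny.
have := compact_separation (@act_continuous _ _ a) hB cN NB By Ny.
move=> [[P Q] /= [Px Qy] PQ]; exists P^°, Q^°; split.
- by split=> //; exact: open_interior.
- by split=> //; exact: open_interior.
move=> n p Nn /interior_subset Pp Bnp /interior_subset Qnp.
by have /= := PQ (p, a n p) (conj Pp Qnp) n Nn Bnp Bnp; apply.
Qed.

Lemma pi_orbit_eq x y :
  \pi_(orbit_space a) x = \pi_(orbit_space a) y <-> gorbit a x y.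
Proof. by split=> [/eqmodP/asboolP|?]; last exact/eqmodP/asboolP. Qed.

(** The saturation of an open set is the union of its translates. *)
Lemma open_pi_orbit (O : set X) :
  open O -> open (\pi_(orbit_space a) @` O).
Proof.
move=> oO; rewrite /open /= /quotient_open.
rewrite (_ : _ @^-1` _ = \bigcup_g a g @^-1` O).
  by apply: bigcup_open => g _; exact: open_act_preimage.
apply/seteqP; split=> [y [x Ox /esym/pi_orbit_eq[g _ E]]|y [g _ Oy]].
  by exists g => //=; rewrite E.
by exists (a g y) => //; apply/esym/pi_orbit_eq; exists g.
Qed.


Lemma mulVg_near1 (N : set G) : nbhs 1 N ->
  exists2 V, nbhs 1 V & forall g h, V g -> V h -> N (g^-1 * h).
Proof.
have C : continuous (fun p : G * G => p.1^-1 * p.2).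
  move=> p; apply: (@continuous_comp _ _ _ (fun p : G * G => (p.1^-1, p.2))
    (fun p : G * G => p.1 * p.2)); last exact: mulg_continuous.
  apply: cvg_pair; last exact: cvg_snd.
  apply: (@continuous_comp _ _ _ fst (fun g : G => g^-1)); first exact: cvg_fst.
  exact: invg_continuous.
have := C (1, 1) N; rewrite /= mulVg.
move=> + N1 => /(_ N1)[[P Q] /= [P1 Q1] PQ]; exists (P `&` Q); first exact: filterI.
by move=> g h [Pg _] [_ Qh]; exact: (PQ (g, h)).
Qed.

Lemma compact_near1 (N : set G) : locally_quasi_compact G -> nbhs 1 N ->
  exists K, [/\ nbhs 1 K, K `<=` N & compact K].
Proof.
move=> Glqc /Glqc[K [K1 KN /cover_compact_compact cK]].
by exists K.
Qed.

(** * From a T0 orbit space to open orbit maps *)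

Lemma kolmogorov_orbit_map_open x :
  hereditary_lindelof G -> locally_quasi_compact G ->
  @second_countable X -> locally_quasi_compact X -> almost_hausdorff X ->
  kolmogorov_space (orbit_space a) -> orbit_map_open x.
Proof.
move=> Ghl Glqc [b cb [bo bb]] Xlqc Xah T0 N N1.
have [W Wx hW] := gorbit_closure_hausdorff_nbhs x Xah.
(* [V] will be compact, with V x inside the Hausdorff piece, so that V x is relatively closed there,
   and with quotients v^-1 w in [N], so that interior found anywhere can be moved back to [x]. *)
have [W1 W11 [W' [_ W'x] WW]] := act_near1 Wx.
have [V1 V11 VN] := mulVg_near1 N1.
have [V [VI VV cV]] := compact_near1 Glqc (filterI W11 V11).
have {WW} VW v : V v -> W (a v x) by move=> /VV[Wv _]; exact: WW.
have {VN} VN v w : V v -> V w -> N (v^-1 * w).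
  by move=> /VV[_ Vv] /VV[_ Vw]; exact: VN.
have [D cD GD] := lindelof_translates Ghl VI.
have clx : closure (gorbit a x) x.
  by apply: subset_closure; exists 1 => //; exact: act1.
have clo g : closure (gorbit a x) (a g x) by exact: closure_gorbit_invariant.
(* As the orbit of x is dense, members of F2 have no interior; since the orbit
   space is T0, they cover what F1 misses, the points outside the orbit. *)
pose F1 := (fun g => [set a g (a v x) | v in V]) @` D.
pose F2 := (fun U => ~` (\bigcup_g a g @^-1` U)) @` (b `&` [set U | U x]).
have [||C|y [cly Wy]|C [Y]] := baire_cover (F := F1 `|` F2) Xlqc
  (@closed_closure _ (gorbit a x)) Wx.1 hW.
- by exists x; split=> //; exact: Wx.2.
- rewrite -bigcup2E; apply: bigcup_countable => // -[_|[_|n _]] /=.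
  + exact: card_le_trans (card_image_le _ _) cD.
  + apply: card_le_trans (card_image_le _ _) _.
    by apply: sub_countable cb; apply: subset_card_le => U [].
  + exact: countable0.
- move=> [[g Dg <-]|[U [bU Ux] <-]].
    (* On the translate g W, pulling [z] back by [g] lands in [W], where it can be separated from V
       x. *)
    exists (a g^-1 @^-1` W); split.
    + by apply: open_act_preimage; exact: Wx.1.
    + by move=> y [_ [v Vv <-]] /=; rewrite actK; exact: VW.
    move=> z [[clz Wz] Wgz] nz.
    have [|||P [Q [[_ Px] [ oQ Qz] PQ]]] :=
      @act_separation V x (a g^-1 z) _ hW cV.
    + by move=> v Vv; split; [exact: clo|exact: VW].
    + by split=> //; exact: closure_gorbit_invariant.
    + by move=> v Vv E; apply: nz; exists v => //; rewrite E actKV.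
    apply: (filterS _ (open_nbhs_nbhs (conj (open_act_preimage g^-1 oQ) Qz))).
    move=> y Qy [_ [v Vv E]]; move: Qy; rewrite /= -E actK.
    by apply: (PQ v x Vv Px); split; [exact: clo|exact: VW].
  exists setT; split=> //; first exact: openT.
  move=> z _ /contrapT Uz.
  have oU : open (\bigcup_g a g @^-1` U).
    by apply: bigcup_open => g _; apply: open_act_preimage; exact: bo.
  by apply: (filterS _ (open_nbhs_nbhs (conj oU Uz))) => y Uy [_].
- apply: contrapT => ny.
  have nxy : ~ gorbit a x y.
    move=> [h _ hxy]; apply: ny; have [g Dg Vgh] := GD h.
    exists [set a g (a v x) | v in V]; first by left; exists g.
    by exists (g^-1 * h) => //; rewrite -actM actKV.
  (* An open set around the class of [x] missing that of [y] puts [y] in a member of [F2]; the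
     opposite case is impossible because [y] is in the closure of the orbit of [x]. *)
  have [|A [|]] := T0 (\pi_(orbit_space a) x) (\pi_(orbit_space a) y).
  + by apply/eqP => /pi_orbit_eq.
  + rewrite !inE => -[/pi_continuous/bb[U [bU Ux] UA] nAy].
    apply: ny; exists (~` (\bigcup_g a g @^-1` U)); first by right; exists U.
    move=> [g _ /UA] /=; suff -> : \pi_(orbit_space a) (a g y) =
      \pi_(orbit_space a) y by [].
    by apply/esym/pi_orbit_eq; exists g.
  + rewrite !inE => -[/pi_continuous/cly[_ [[g _ <-]]]] /= + nAx.
    suff -> : \pi_(orbit_space a) (a g x) = \pi_(orbit_space a) x by [].
    by apply/esym/pi_orbit_eq; exists g.
- move=> [FC oY [z BYz] BYC].
  case: FC => [[g Dg CE]|[U [bU Ux] CE]]; rewrite -CE in BYC; last first.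
    have [|g [Wg Yg]] := @gorbit_dense x _ (openI Wx.1 oY).
      by case: BYz => -[clz Wz] Yz; exists z.
    case: (BYC (a g x)); first by split=> //; split=> //; exact: clo.
    by exists g^-1 => //=; rewrite actK.
  have [v Vv zE] := BYC _ BYz.
  (* Since g v x = z, this set contains [x]. If it contains k x, then g v k x = g w x with [w] in
     [V], whence k x = v^-1 w x. *)
  exists (a (g * v) @^-1` (W `&` Y)).
    split; first by apply: open_act_preimage; exact: openI Wx.1 oY.
    by rewrite /= -actM zE; case: BYz => -[].
  move=> k [Wk Yk]; have [|w Vw E] := BYC (a (g * v) (a k x)).
    by split=> //; split=> //; rewrite actM; exact: clo.
  exists (v^-1 * w); first exact: VN.
  by rewrite -actM -(actK a g (a w x)) E -actM actK actK.
Qed.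

(** * From open orbit maps back to T0 *)

Lemma orbit_map_open_kolmogorov :
  locally_quasi_compact G -> almost_hausdorff X ->
  (forall x, orbit_map_open x) -> kolmogorov_space (orbit_space a).
Proof.
move=> Glqc Xah small p q; rewrite -[p]reprK -[q]reprK.
move: (repr p) (repr q) => x y xy.
have {}xy : ~ gorbit a x y by move=> /pi_orbit_eq E; rewrite E eqxx in xy.
have clx g : closure (gorbit a x) (a g x).
  by apply: subset_closure; exists g.
have [cly|ncly] := pselect (closure (gorbit a x) y); last first.
  exists (\pi_(orbit_space a) @` (~` closure (gorbit a x))); right.
  rewrite !inE; split.
    apply: open_nbhs_nbhs; split; last by exists y.
    by apply: open_pi_orbit; exact/closed_openC/closed_closure.
  move=> [z nclz /esym/pi_orbit_eq xz]; apply: nclz; exact: subset_closure.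
have [W Wx hW] := gorbit_closure_hausdorff_nbhs x Xah.
have [W1 W11 [W' [_ W'x] WW]] := act_near1 Wx.
have [K [K1 KW cK]] := compact_near1 Glqc W11.
have [Y [oY Yx] YK] := small x K K1.
(* If g y lay in [Y] and [W], it would be a limit of orbit points in [Y], all of which lie in K x.
   But K x is compact in the Hausdorff piece, so g y would lie in K x and [y] in the orbit of
   [x]. *)
exists (\pi_(orbit_space a) @` (Y `&` W)); left.
rewrite !inE; split.
  apply: open_nbhs_nbhs; split; last by exists x => //; split=> //; exact: Wx.2.
  by apply: open_pi_orbit; exact: openI oY Wx.1.
move=> [_z [Yz Wz] /esym/pi_orbit_eq[g _ E]]; rewrite -{_z}E in Yz Wz.
have clz : closure (gorbit a x) (a g y) by exact: closure_gorbit_invariant.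
have [|||P [Q [[_ Px] [ oQ Qz] PQ]]] := @act_separation K x (a g y) _ hW cK.
- by move=> n /KW W1n; split; [exact: clx|exact: WW].
- by [].
- move=> n Kn E; apply: xy; apply: (@gorbit_trans _ (a g y)).
    by exists n.
  by apply: gorbit_sym; exists g.
have [|_ [[h _ <-] [Yh Qh]]] := clz (Y `&` Q).
  by apply: open_nbhs_nbhs; split; first exact: openI.
have [n Kn E] := YK _ Yh.
rewrite -E in Qh; apply: (PQ _ _ Kn Px _ Qh).
by split; [exact: clx|apply: WW => //; exact: KW].
Qed.

(** * Open orbit maps and homogeneous orbits *)

(** The projection onto cosets is open, since saturating means taking right translates by the
    stabilizer; the inverse homeomorphism turns the image of the interior of [N] into a relatively
    open part of the orbit. *)
Lemma homogeneous_orbit_map_open x :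
  homogeneous_orbit a x -> orbit_map_open x.
Proof.
move=> [_ [f [fK Kf fc]]] N N1.
pose M := \pi_(stabilizer_quotient a x) @` N^°.
have oM : open M.
  rewrite /open /= /quotient_open.
  rewrite (_ : _ @^-1` _ = \bigcup_(s in stabilizer a x)
    [set h : G | N^° (h * s^-1)]).
    apply: bigcup_open => s _.
    by have /continuousP/(_ _ (@open_interior _ N)) := @mulgr_continuous G s^-1.
  apply/seteqP; split=> [h [n Nn /eqmodP/lcoset_relP E]|h [s sx Nhs]].
    exists (n^-1 * h); last by rewrite /= invgM invgK mulVKg.
    by rewrite /stabilizer /= -actM -E actK.
  exists (h * s^-1) => //; apply/eqmodP/lcoset_relP.
  by rewrite -actM -[in LHS]sx actK.
have /continuousP/(_ _ oM)[ O oO OM] := fc.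
have valf g (Hg : a g x \in gorbit a x) :
    f (exist _ (a g x) Hg) = \pi_(stabilizer_quotient a x) g.
  rewrite -(fK (\pi_(stabilizer_quotient a x) g)); congr f; apply: eq_sig_hprop => //.
  by rewrite -[RHS]/(set_val _) orbit_mapE.
have OE g : O (a g x) <-> M (\pi_(stabilizer_quotient a x) g).
  have := mem_set (ex_intro2 _ _ g I erefl : gorbit a x (a g x)) => Hg.
  by rewrite -(valf g Hg) -[M _]/((f @^-1` M) _) -OM.
exists O.
  split=> //; rewrite -[x](act1 a); apply/OE; exists 1 => //.
move=> g /OE[n /interior_subset Nn /eqmodP/lcoset_relP E].
by exists n.
Qed.

Lemma orbit_map_open_homogeneous x :
  orbit_map_open x -> homogeneous_orbit a x.
Proof.
move=> small; split.
  apply/quotient_continuous; apply/continuous_comp_initial.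
  rewrite (_ : _ \o _ = a^~ x); first exact: actr_continuous.
  by apply/funext => g /=; rewrite orbit_mapE.
have [|r rP] := @choice (set_type (gorbit a x)) G
    (fun (y : set_type (gorbit a x)) g => a g x = set_val y).
  by case=> y Hy; have [g _ E] := set_mem Hy; exists g.
have orbitK g (y : set_type (gorbit a x)) : a g x = set_val y ->
    \pi_(stabilizer_quotient a x) (r y) = \pi g.
  by move=> E; apply/eqmodP/lcoset_relP; rewrite rP.
exists (fun y : set_type (gorbit a x) => \pi_(stabilizer_quotient a x) (r y)); split.
- by move=> c; rewrite -[RHS]reprK; apply: orbitK.
- move=> y; apply: eq_sig_hprop => //.
  by rewrite -[LHS]/(set_val _) orbit_mapE rP.
move=> y M /pi_continuous My.
(* Left translation by [r y] reduces continuity at [y] to openness at the identity. *)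
have N1 : nbhs 1 [set n | M (\pi_(stabilizer_quotient a x) (r y * n))].
  apply: (@mulgl_continuous G (r y) 1 (\pi_(stabilizer_quotient a x) @^-1` M)).
  by rewrite mulg1.
have [ O [ oO Ox] ON] := small _ N1.
have : nbhs y (set_val @^-1` (a (r y)^-1 @^-1` O)).
  apply: open_nbhs_nbhs; split; last by rewrite /= -rP actK.
  by exists (a (r y)^-1 @^-1` O) => //; exact: open_act_preimage.
apply: filterS => z /=; rewrite -(rP z) actM => /ON[n Mn E].
rewrite (orbitK (r y * n)) //.
by rewrite -actM E actM mulVKg rP.
Qed.

(** * From open orbit maps to an almost Hausdorff orbit space *)

Lemma orbit_map_open_almost_hausdorff :
  locally_quasi_compact G ->
  @second_countable X -> locally_quasi_compact X -> almost_hausdorff X ->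
  (forall x, orbit_map_open x) -> almost_hausdorff (orbit_space a).
Proof.
move=> Glqc [b cb [bo bb]] Xlqc Xah small A0 cA0 [p0 A0p0].
pose A := \pi_(orbit_space a) @^-1` A0.
have cA : closed A by apply: closed_comp cA0 => x _; exact: pi_continuous.
have Aact g x : A x -> A (a g x).
  rewrite /A /=; suff -> : \pi_(orbit_space a) (a g x) =
    \pi_(orbit_space a) x by [].
  by apply/esym/pi_orbit_eq; exists g.
have A0' : A !=set0 by exists (repr p0); rewrite /A /= reprK.
have [W [oW [x0 [Ax0 Wx0]] /hausdorff_onP hW]] := Xah A cA A0'.
have [W1 W11 [W' [oW' W'x0] WW]] := act_near1 (conj oW Wx0).
have [N [N1 NW1 cN]] := compact_near1 Glqc W11.
have {}WW n x : N n -> W' x -> W (a n x) by move=> /NW1; exact: WW.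
have W'W : W' `<=` W.
  by move=> x /(WW 1); rewrite act1; apply; exact: nbhs_singleton.
have sep x y : A x -> W' x -> A y -> W' y -> ~ [set a n x | n in N] y ->
    exists P Q : set X, [/\ open_nbhs x P, open_nbhs y Q &
    forall n p, N n -> P p -> (A `&` W) (a n p) -> ~ Q (a n p)].
  move=> Ax Wx Ay Wy nxy; apply: act_separation hW cN _ _ _.
  - by move=> n Nn; split; [exact: Aact|exact: WW].
  - by split=> //; exact: W'W.
  - by move=> n Nn E; apply: nxy; exists n.
(* E U is relatively closed in U, as N is compact and N W' lies in W. *)
pose E (U : set X) := [set x | [/\ W' x, U x &
  forall g, U (a g x) -> W' (a g x) -> [set a n x | n in N] (a g x)]].
have [|||C|y [Ay Wy]|C [Y [[U bU <-] oY [z [[Az Wz] Yz]] YE]]] :=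
  baire_cover (F := E @` b) Xlqc cA oW' _.
- by apply: hausdorff_onS hW => x [Ax /W'W].
- by exists x0.
- exact: card_le_trans (card_image_le _ _) cb.
- move=> [U bU <-]; exists U; split; first exact: bo.
    by move=> x [_ []].
  move=> z [[Az Wz] Uz] nEz.
  (* One [g] witnessing failure at [z] serves all nearby points: compact separation keeps g p
     outside N p for [p] in the trace near [z]. *)
  have [g [Ug Wg ng]] : exists g, [/\ U (a g z), W' (a g z) &
      ~ [set a n z | n in N] (a g z)].
    apply: contrapT => /forallNP H; apply: nEz; split=> // g Ug Wg.
    by apply: contrapT => ng; apply: (H g).
  have [P [Q [[ oP Pz] [ oQ Qg] PQ]]] := sep z (a g z) Az Wz (Aact g z Az) Wg ng.
  have : nbhs z (P `&` a g @^-1` (Q `&` U `&` W')).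
    apply: open_nbhs_nbhs; split => //; apply: openI => //.
    apply: open_act_preimage; apply: openI => //; apply: openI => //.
    exact: bo.
  apply: filterS => p [Pp [[Qp Up] Wp]] [[Ap _] [_ _ /(_ g Up Wp)[n Nn En]]].
  apply: (PQ n p) => //; rewrite En //; split; [exact: Aact|exact: W'W].
(* Openness at [y] confines its orbit points in [Y] to N y; a basic [U] inside [Y] inherits this. *)
- have [Y [oY Yy] YN] := small y N N1.
  have [U [bU Uy] UY] := bb y Y (open_nbhs_nbhs (conj oY Yy)).
  exists (E U); first by exists U.
  split=> // g /UY/YN[n Nn En] _; by exists n.
have {}YE x g : A x -> W' x -> Y x -> W' (a g x) -> Y (a g x) ->
    [set a n x | n in N] (a g x).
  move=> Ax Wx Yx Wg Yg.
  have [_ _ H] := YE x (conj (conj Ax Wx) Yx).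
  have [_ Ug _] := YE (a g x) (conj (conj (Aact g x Ax) Wg) Yg).
  exact: H.
have oYW : open (Y `&` W') by exact: openI.
exists (\pi_(orbit_space a) @` (Y `&` W')); split.
- exact: open_pi_orbit.
- by exists (\pi_(orbit_space a) z); split=> //; exists z.
apply/hausdorff_onP => p q [Ax [x [Yx Wx] px]] [Ay [y [Yy Wy] qy]].
rewrite -{p}px -{q}qy in Ax Ay * => xy.
have [|P [Q [[ oP Px] [ oQ Qy] PQ]]] := sep x y Ax Wx Ay Wy.
  by move=> [n _ E']; apply: xy; apply/pi_orbit_eq; exists n.
(* A common orbit would give [u] in [P] and g u in [Q], both in [Y] and [W']. Then [YE] makes g u a
   translate of [u] by [N], which [PQ] forbids. *)
exists (\pi_(orbit_space a) @` (P `&` (Y `&` W'))),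
  (\pi_(orbit_space a) @` (Q `&` (Y `&` W'))); split.
- by split; [apply: open_pi_orbit; exact: openI|exists x].
- by split; [apply: open_pi_orbit; exact: openI|exists y].
apply/seteqP; split=> // q [[[u [Pu [Yu Wu]] uq]]].
rewrite -{q}uq => -[v [Qv [Yv Wv]] /esym/pi_orbit_eq[g _ E']] [Au _].
rewrite -{v}E' in Qv Yv Wv.
have [n Nn En] := YE u g Au Wu Yu Wv Yv.
apply: (PQ n u) => //; rewrite En //; split; [exact: Aact|exact: W'W].
Qed.

End Action.

(** * The remaining implication and the equivalence *)

(** A Hausdorff open piece of the closure of the two points contains at least one of them. If it
    contains only one, it separates them; if both, Hausdorffness does. *)
Lemma almost_hausdorff_kolmogorov (Y : topologicalType) :
  almost_hausdorff Y -> kolmogorov_space Y.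
Proof.
move=> Yah x y xy.
have xx : closure [set x; y] x by apply: subset_closure; left.
have yy : closure [set x; y] y by apply: subset_closure; right.
have [|V [oV [z [clz Vz]] /hausdorff_onP hV]] := Yah _ (@closed_closure _ [set x; y]).
  by exists x.
have nV u : V u -> nbhs u V by move=> ?; exact: open_nbhs_nbhs.
have [Vx|nVx] := pselect (V x); have [Vy|nVy] := pselect (V y).
- have [|||P [Q [[ oP Px] [ oQ Qy] PQ]]] := hV x y => //; first exact/eqP.
  exists (V `&` P); left; rewrite !inE; split.
    by apply: open_nbhs_nbhs; split=> //; exact: openI.
  by move=> [_ Py]; have : set0 y by rewrite -PQ.
- by exists V; left; rewrite !inE; split=> //; exact: nV.
- by exists V; right; rewrite !inE; split=> //; exact: nV.
- have [_ [[->|->] //]] := clz V (nV _ Vz).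
Qed.

Theorem theorem21 (G : topologicalGroupType) (X : topologicalType)
    (a : gspace G X)
    (G_T0 : kolmogorov_space G) (X_T0 : kolmogorov_space X)
    (G_hl : hereditary_lindelof G) (G_lc : locally_compact_hausdorff G)
    (X_sc : @second_countable X) (X_lqc : locally_quasi_compact X)
    (X_ah : almost_hausdorff X) :
  (almost_hausdorff (orbit_space a) <-> kolmogorov_space (orbit_space a)) /\
  (kolmogorov_space (orbit_space a) <-> forall x : X, homogeneous_orbit a x).
Proof.
have [G_lqc _] := G_lc.
have T0small : kolmogorov_space (orbit_space a) -> forall x, orbit_map_open a x.
  by move=> T0 x; exact: kolmogorov_orbit_map_open.
split; split.
- exact: almost_hausdorff_kolmogorov.
- by move=> /T0small; exact: orbit_map_open_almost_hausdorff.
- by move=> /T0small small x; exact: orbit_map_open_homogeneous.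
- move=> hom; apply: orbit_map_open_kolmogorov => // x.
  exact: homogeneous_orbit_map_open.
Qed.
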